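(* Let $r\ge 2$ and let $F$ be an $r$-graph. If $F$ is $r$-partite, then $\gamma^+(F)=0$.
   Context: An $r$-graph is a finite $r$-uniform hypergraph. It is $r$-partite if its vertex set can be partitioned into $r$ classes $V_1,\dots,V_r$ such that each edge intersects each class in at most one vertex. The minimum positive co-degree $\delta_{r-1}^+(H)$ of a non-empty $r$-graph $H$ is the maximum $k$ such that every $(r-1)$-set of vertices contained in some edge of $H$ is contained in at least $k$ distinct edges of $H$; by convention it is $0$ if $H$ has no edges. A hypergraph is $F$-free if it has no (not necessarily induced) subhypergraph isomorphic to $F$. $\mathrm{co^+ex}(n,F)$ is the maximum of $\delta_{r-1}^+(H)$ over all $n$-vertex $F$-free $r$-graphs $H$ (taken to be $0$ if there are none), and $\gamma^+(F)=\lim_{n\to\infty}\mathrm{co^+ex}(n,F)/n$ (this limit exists). *)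

(* Defs.v *)
(* Mathematical Components with MathComp-Analysis. *)
From mathcomp Require Import all_boot all_order all_algebra.
From mathcomp Require Import reals topology normedtype sequences.

Set Implicit Arguments.
Unset Strict Implicit.
Unset Printing Implicit Defensive.

Import numFieldNormedType.Exports.

(* A finite hypergraph with vertex set the finite type T is represented by its
   edge set {set {set T}}; isolated vertices are allowed. *)
Definition is_rgraph (T : finType) (r : nat) (H : {set {set T}}) : bool :=
  [forall e in H, #|e| == r].

(* Empty classes are allowed. *)
Definition partite (T : finType) (r : nat) (H : {set {set T}}) : Prop :=
  exists P : 'I_r -> {set T},
    [/\ forall i j, i != j -> [disjoint P i & P j],
        forall v, exists i, v \in P i
      & forall e i, e \in H -> #|e :&: P i| <= 1].

Definition codegree (T : finType) (H : {set {set T}}) (S : {set T}) : nat :=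
  #|[set e in H | S \subset e]|.

(* When H is a non-empty r-graph with r > 0, every admissible k is at most
   the codegree of some S, hence at most #|H|, so restricting k to that range
   loses nothing; when H has no edges only k = 0 remains. *)
Definition min_pos_codegree (T : finType) (r : nat) (H : {set {set T}}) : nat :=
  \max_(k < #|H|.+1 | [forall S : {set T},
      (#|S| == r.-1) && [exists e in H, S \subset e] ==> (k <= codegree H S)])
    k.

(* A not necessarily induced copy of F in H is the image of F under an
   injection of the vertices that maps edges to edges. *)
Definition contains (V T : finType) (F : {set {set V}}) (H : {set {set T}})
    : bool :=
  [exists f : {ffun V -> T}, injectiveb f && [forall e in F, f @: e \in H]].

(* An empty \max is 0. *)
Definition coex_pos (V : finType) (r : nat) (F : {set {set V}}) (n : nat)
    : nat :=
  \max_(H : {set {set 'I_n}} | is_rgraph r H && ~~ contains F H)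
    min_pos_codegree r H.

Local Open Scope ring_scope.

Definition coex_pos_density (R : realType) (V : finType) (r : nat)
    (F : {set {set V}}) (n : nat) : R :=
  (coex_pos r F n)%:R / n%:R.

(* limn has a junk value on divergent sequences, so an equation about gamma_pos
   is only meaningful together with cvgn (coex_pos_density R r F). *)
Definition gamma_pos (R : realType) (V : finType) (r : nat)
    (F : {set {set V}}) : R :=
  limn (coex_pos_density R r F).

(* Main.v *)
(* Let H have n vertices and positive co-degree at least d > 0. Starting from one
   edge and replacing its vertices one at a time gives at least d^r ordered
   edges, so if d >= n/c the ordered edges have density at least 1/c^r. By
   Erdős's theorem H then contains, for large n, a complete r-partite r-graph
   with classes of size |V(F)|, and hence F. Erdős's theorem is proved by
   induction on the uniformity: convexity of d ^_ t provides a t-set T whose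
   common link is still dense. *)
Require Import Defs.
From mathcomp Require Import classical_sets.
From mathcomp Require Import all_boot all_order all_algebra.
From mathcomp Require Import reals topology normedtype sequences.
From mathcomp Require Import zify.
Import numFieldNormedType.Exports.

(** * Dense relations on tuples contain boxes *)

Lemma sum_tupleS (X : finType) (k : nat) (f : seq X -> nat) :
  \sum_(s : k.+1.-tuple X) f s = \sum_(x : X) \sum_(s : k.-tuple X) f (x :: s).
Proof.
rewrite pair_big /= (reindex (fun p : X * k.-tuple X => [tuple of p.1 :: p.2])) //.
exists (fun s => (thead s, [tuple of behead s])) => [[x s] _|s _] /=.
  by rewrite theadE; congr (_, _); apply: val_inj.
by rewrite [RHS]tuple_eta; apply: val_inj.
Qed.

Lemma sum_tuple0 (X : finType) (f : seq X -> nat) :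
  \sum_(s : 0.-tuple X) f s = f [::].
Proof.
by rewrite (big_pred1 [tuple]) // => s; apply/esym/eqP; exact: tuple0.
Qed.

Lemma leq_subn_exp_ffact (d t : nat) : (d - t) ^ t <= d ^_ t.
Proof.
elim: t d => [|t IHt] [|d] //; first by rewrite sub0n exp0n.
rewrite ffactnS subSS expnS leq_mul //.
exact: leq_trans (leq_subr _ _) (leqnSn d).
Qed.

Lemma leq_ffact_exp (n t : nat) : n ^_ t <= n ^ t.
Proof.
elim: t n => [|t IHt] [|n] //.
rewrite ffactnS expnS leq_mul //.
by apply: leq_trans (IHt n) _; case: t {IHt} => // t; rewrite leq_exp2r.
Qed.

(* A chord bound for the convex function [d ^_ t]; being linear in [d], it can
   be summed over all tuples. *)
Lemma ffact_chord (c t n d : nat) :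
  4 * c * t <= n -> d <= n ->
  n ^ t * (2 * c * d) <= n ^ t * n + 2 * c * (4 * c) ^ t * n * d ^_ t.
Proof.
move=> htn hdn; have [le_dn|lt_nd] := leqP (2 * c * d) n.
  by apply: leq_trans (leq_addr _ _); rewrite leq_mul2l le_dn orbT.
apply: leq_trans (leq_addl _ _).
(* Here [2 * c * d] exceeds [n] and [4 * c * t <= n], so [4 * c * (d - t)] is at least
   [2 * n - n]. *)
have h : n ^ t <= (4 * c) ^ t * d ^_ t.
  apply: leq_trans (_ : (4 * c * (d - t)) ^ t <= _).
    case: t htn => // t htn; rewrite leq_exp2r //; nia.
  by rewrite expnMn leq_mul2l leq_subn_exp_ffact orbT.
have -> : 2 * c * (4 * c) ^ t * n * d ^_ t
   = ((4 * c) ^ t * d ^_ t) * (2 * c * n) by lia.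
by rewrite leq_mul // leq_mul.
Qed.

(** Double counting of pairs of a [t]-set [T] and a tuple [s] with [x :: s] in [R] for all [x] in
    [T]: convexity gives many pairs in total, so an average [T] serves. *)
Lemma dense_link (X : finType) (k c t : nat) (R : pred (seq X)) :
  0 < #|X| -> 4 * c * t <= #|X| ->
  #|X| ^ k.+1 <= c * \sum_(s : k.+1.-tuple X) R s ->
  exists2 T : {set X}, #|T| = t &
    #|X| ^ k <= 2 * c * (4 * c) ^ t *
      \sum_(s : k.-tuple X) [forall x in T, R (x :: s)].
Proof.
set n := #|X|; move=> n0 htn hR.
set C := 2 * c * (4 * c) ^ t.
pose N (s : seq X) := [set x | R (x :: s)].
have sumN : \sum_(s : k.+1.-tuple X) R s = \sum_(s : k.-tuple X) #|N s|.
  rewrite (sum_tupleS _ _ (fun s => R s : nat)) exchange_big /=.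
  apply: eq_bigr => s _; rewrite -sum1_card [RHS]big_mkcond /=.
  by apply: eq_bigr => x _; rewrite inE; case: (R _).
(* Summing the chord bound over [s], the left side is at least twice the error term
   [n ^ t * n * n ^ k] by [hR]; half of it survives, and a factor [n] cancels. *)
have chord : n ^ t * n ^ k <= C * \sum_(s : k.-tuple X) #|N s| ^_ t.
  have : \sum_(s : k.-tuple X) n ^ t * (2 * c * #|N s|) <=
         \sum_(s : k.-tuple X) (n ^ t * n + C * n * #|N s| ^_ t).
    by apply: leq_sum => s _; apply: ffact_chord => //; apply: max_card.
  rewrite big_split /= -!big_distrr /= -sumN sum_nat_const card_tuple -/n.
  set A := \sum_s _ in hR *; set B := \sum_s _.
  have := hR; rewrite expnS => {}hR h.
  rewrite -(leq_pmul2r n0).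
  have : n ^ t * (2 * (n * n ^ k)) <= n ^ t * (2 * c * A).
    by rewrite leq_mul2l -mulnA leq_mul2l hR /= orbT.
  move: h; lia.
have draws (s : seq X) : #|N s| ^_ t =
    t`! * \sum_(T : {set X} | #|T| == t) [forall x in T, R (x :: s)].
  rewrite -bin_ffact -cards_draws mulnC -sum1_card; congr (_ * _).
  rewrite big_mkcond [RHS]big_mkcond /=; apply: eq_bigr => T _; rewrite inE.
  have -> : (T \subset N s) = [forall x in T, R (x :: s)].
    apply/subsetP/forall_inP => h x /h; by rewrite inE.
  by case: eqP => _; case: [forall x in T, _].
case: (boolP [exists T : {set X}, (#|T| == t) &&
   (n ^ k <= C * \sum_(s : k.-tuple X) [forall x in T, R (x :: s)])]).
  by case/existsP => T /andP[/eqP hT h]; exists T.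
rewrite negb_exists => /forallP hno.
(* At least one [t]-set must exist for the sum over all of them to be strictly small. The case
   [c = 0] contradicts [hR]. *)
have tn : t <= n.
  case: c htn hR {C chord hno} => [|c] htn hR; last by nia.
  by move: hR; rewrite mul0n leqn0 expn_eq0 /= eqn0Ngt n0.
exfalso; move: chord; apply/negP; rewrite -ltnNge.
under eq_bigr do rewrite draws.
rewrite -big_distrr exchange_big /=.
have lt : C * \sum_(T : {set X} | #|T| == t) \sum_(s : k.-tuple X) [forall x in T, R (x :: s)]
   < 'C(n, t) * n ^ k.
  have -> : 'C(n, t) = #|[set T : {set X} | #|T| == t]|.
    by rewrite card_draws.
  rewrite big_distrr -sum_nat_const /=.
  under [X in _ < X]eq_bigl do rewrite inE.
  have [T0 hT0] : exists T0 : {set X}, #|T0| == t.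
    have : 0 < #|[set T : {set X} | #|T| == t]| by rewrite card_draws bin_gt0.
    by case/card_gt0P => T; rewrite inE => h; exists T.
  rewrite (bigD1 T0) //= [X in _ < X](bigD1 T0) //= -addSn leq_add //.
    by have := hno T0; rewrite hT0 /= -ltnNge.
  apply: leq_sum => T /andP[hT _].
  by have := hno T; rewrite hT /= -ltnNge; apply: ltnW.
(* Multiplying by [t!] turns ['C(n, t)] into [n ^_ t], which is at most [n ^ t]. *)
rewrite mulnCA; apply: leq_trans (_ : t`! * ('C(n, t) * n ^ k) <= _).
  by rewrite ltn_pmul2l ?fact_gt0.
by rewrite mulnA [t`! * _]mulnC bin_ffact leq_mul2r leq_ffact_exp orbT.
Qed.

(** The first class is a [t]-set with dense common link; the induction hypothesis, at the worse
    constant [2 * c * (4 * c) ^ t], finds the other classes inside that link. *)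
Lemma dense_box_seq (k c t : nat) : exists N : nat,
  forall (X : finType) (R : pred (seq X)), N <= #|X| ->
  #|X| ^ k <= c * \sum_(s : k.-tuple X) R s ->
  exists Ts : seq {set X}, [/\ size Ts = k, all (fun T : {set X} => #|T| == t) Ts &
    forall s, all2 (fun x (T : {set X}) => x \in T) s Ts -> R s].
Proof.
elim: k c => [|k IHk] c.
  exists 0 => X R _; rewrite (sum_tuple0 _ (fun s => R s : nat)) expn0 => hR.
  exists [::]; split=> // -[|//] _.
  by move: hR; case: (R _); rewrite // muln0.
have [N hN] := IHk (2 * c * (4 * c) ^ t).
exists (maxn N (maxn 1 (4 * c * t))) => X R.
rewrite !geq_max => /and3P[hNX n0 htn] hR.
have [T hT dense] := dense_link _ _ _ _ _ n0 htn hR.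
have [Ts [szTs cardTs boxTs]] := hN X (fun s => [forall x in T, R (x :: s)]) hNX dense.
exists (T :: Ts); split=> /=; rewrite ?szTs ?hT ?eqxx //.
by case=> // x s /andP[xT /boxTs/forall_inP]; apply.
Qed.

(* Erdős's theorem on complete k-partite subhypergraphs. *)
Theorem dense_box (k c t : nat) : exists N : nat,
  forall (X : finType) (R : pred (seq X)), N <= #|X| ->
  #|X| ^ k <= c * \sum_(s : k.-tuple X) R s ->
  exists2 T : 'I_k -> {set X}, forall i, #|T i| = t &
    forall g : 'I_k -> X, (forall i, g i \in T i) -> R (codom g).
Proof.
have [N hN] := dense_box_seq k c t; exists N => X R hX hR.
have [Ts [szTs cardTs boxTs]] := hN X R hX hR.
exists (fun i : 'I_k => nth set0 Ts i) => [i|g gT].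
  by apply/eqP/(all_nthP _ cardTs); rewrite szTs.
apply: boxTs.
have -> : Ts = [seq nth set0 Ts (val i) | i <- enum 'I_k].
  by rewrite (map_comp (nth set0 Ts)) val_enum_ord -szTs; rewrite -[LHS](mkseq_nth set0).
by rewrite /codom /image_mem; elim: (enum _) => //= i s ->; rewrite gT.
Qed.

(** * Counting ordered edges from the positive co-degree *)

Definition ordered_edge {T : finType} (H : {set {set T}}) : pred (seq T) :=
  fun s => uniq s && ([set x in s] \in H).

Lemma codegree_le_extensions (T : finType) (r : nat) (H : {set {set T}})
    (S : {set T}) :
  is_rgraph r H -> #|S|.+1 = r ->
  codegree H S <= #|[set x | (x \notin S) && (x |: S \in H)]|.
Proof.
move=> /forall_inP rH cardS.
apply: leq_trans (leq_imset_card (fun x => x |: S) _); apply: subset_leq_card.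
apply/subsetP => e; rewrite inE => /andP[eH Se].
have /cards1P[x defx] : #|e :\: S| == 1.
  by rewrite cardsDS // (eqP (rH e eH)) -cardS subSn // subnn.
have defe : e = x |: S by rewrite -defx setUC -{1}(setID e S) (setIidPr Se).
have /setDP[_ xS] : x \in e :\: S by rewrite defx set11.
by apply/imsetP; exists x => //; rewrite inE xS -defe.
Qed.

(* Replace the entries of [q] one at a time: each removal leaves an (r-1)-subset
   of an edge, which extends in at least [d] ways. *)
Lemma ordered_edges_ge (T : finType) (r d : nat) (H : {set {set T}}) :
  is_rgraph r H ->
  (forall S : {set T}, #|S| = r.-1 -> (exists2 e, e \in H & S \subset e) ->
    d <= codegree H S) ->
  forall p q : seq T, size (p ++ q) = r -> ordered_edge H (p ++ q) ->
  d ^ size q <= \sum_(s : (size q).-tuple T) ordered_edge H (p ++ s).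
Proof.
move=> rH codeg p q; elim: q p => [|y q IHq] p sz edge_pq.
  by rewrite (sum_tuple0 _ (fun s => ordered_edge H (p ++ s) : nat)) edge_pq.
rewrite /= expnS (sum_tupleS _ _ (fun s => ordered_edge H (p ++ s) : nat)).
have perm x : perm_eq (p ++ x :: q) (x :: p ++ q) by rewrite -cat1s perm_catCA.
have edge_perm x : ordered_edge H (p ++ x :: q)
    = (x \notin [set z in p ++ q]) && uniq (p ++ q)
      && (x |: [set z in p ++ q] \in H).
  rewrite /ordered_edge (perm_uniq (perm x)) /= inE -set_cons; congr (_ && (_ \in H)).
  by apply/setP => z; rewrite !inE (perm_mem (perm x)).
set S := [set z in p ++ q] in edge_perm.
move: edge_pq; rewrite edge_perm => /andP[/andP[_ pq_uniq] yS].
have cardS : #|S|.+1 = r.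
  by rewrite cardsE (card_uniqP pq_uniq) -sz !size_cat addnS.
have dle : d <= #|[set x | (x \notin S) && (x |: S \in H)]|.
  apply: leq_trans (codegree_le_extensions _ _ _ _ rH cardS).
  apply: codeg; first by rewrite -cardS.
  by exists (y |: S) => //; apply: subsetUr.
apply: leq_trans (_ : #|[set x | (x \notin S) && (x |: S \in H)]| * d ^ size q <= _).
  by rewrite leq_mul2r dle orbT.
rewrite -sum_nat_const big_mkcond /=; apply: leq_sum => x _.
rewrite inE; case: andP => // -[xS xSH].
have := IHq (rcons p x); rewrite cat_rcons edge_perm xS pq_uniq xSH => h.
apply: leq_trans (h _ isT) _; first by rewrite -sz !size_cat.
by apply: leq_sum => s _; rewrite cat_rcons.
Qed.

Lemma min_pos_codegreeP (T : finType) (r : nat) (H : {set {set T}}) (S : {set T}) :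
  #|S| = r.-1 -> (exists2 e, e \in H & S \subset e) ->
  min_pos_codegree r H <= codegree H S.
Proof.
move=> cardS [e eH Se]; apply/bigmax_leqP => k /forallP/(_ S)/implyP; apply.
by rewrite cardS eqxx; apply/exists_inP; exists e.
Qed.

Lemma min_pos_codegree_gt0 (T : finType) (r : nat) (H : {set {set T}}) :
  0 < min_pos_codegree r H -> exists e, e \in H.
Proof.
move=> h; apply/set0Pn; apply: contraTneq h => ->; rewrite -leqNgt.
by apply/bigmax_leqP => -[k]; rewrite cards0.
Qed.

Lemma ordered_edges_density (T : finType) (r : nat) (H : {set {set T}}) :
  is_rgraph r H -> 0 < min_pos_codegree r H ->
  min_pos_codegree r H ^ r <= \sum_(s : r.-tuple T) ordered_edge H s.
Proof.
move=> rH /min_pos_codegree_gt0[e eH].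
have sze : size (enum e) = r by rewrite -cardE; apply/eqP/(forall_inP rH).
have := ordered_edges_ge _ _ _ _ rH (min_pos_codegreeP _ r H) [::] (enum e) sze.
rewrite sze; apply; rewrite /ordered_edge enum_uniq /=.
by rewrite set_enum.
Qed.

(** * Embedding an r-partite r-graph into a box *)

Lemma partite_colouring (V : finType) (r : nat) (F : {set {set V}}) :
  partite r F -> exists c : V -> 'I_r, forall e, e \in F -> {in e &, injective c}.
Proof.
case=> P [_ cover small]; have [c cP] := fin_all_exists cover.
exists c => e eF v w ve we cvw; have := small e (c v) eF.
by move/card_le1_eqP; apply; rewrite inE ?ve ?we //= cvw.
Qed.

Lemma box_contains (V X : finType) (r : nat) (F : {set {set V}})
    (H : {set {set X}}) (T : 'I_r -> {set X}) :
  is_rgraph r F -> partite r F -> (forall i, #|T i| = #|V|) ->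
  (forall g : 'I_r -> X, (forall i, g i \in T i) -> ordered_edge H (codom g)) ->
  contains F H.
Proof.
move=> rF /partite_colouring[c c_inj] cardT box.
(* Each class has [#|V|] elements, so [v] can go to the element of its class [T (c v)] whose
   position is the rank of [v]. *)
pose f v := enum_val (cast_ord (esym (cardT (c v))) (enum_rank v)).
have fT v : f v \in T (c v) by apply: enum_valP.
have f_inj : injective f.
  move=> v w fvw; have [cvw|ncvw] := eqVneq (c v) (c w).
    move: fvw; rewrite /f; move: (cardT (c v)) (cardT (c w)); rewrite cvw => e1 e2.
    rewrite (eq_irrelevance e1 e2).
    by move/enum_val_inj/cast_ord_inj/enum_rank_inj.
  (* A transversal through both [f v] and [f w]; being an ordered edge, it has no repeated entry. *)
  pose g i := if i == c w then f w else enum_val (cast_ord (esym (cardT i)) (enum_rank v)).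
  have gT i : g i \in T i by rewrite /g; case: eqP => [->|_]; [apply: fT | apply: enum_valP].
  have /andP[/injectiveP g_inj _] := box g gT.
  have gvw : g (c v) = g (c w) by rewrite /g eqxx (negPf ncvw).
  by rewrite (g_inj _ _ gvw) eqxx in ncvw.
apply/existsP; exists (finfun f); apply/andP; split.
  by apply/injectiveP => v w; rewrite !ffunE; apply: f_inj.
apply/forall_inP => e eF.
(* An edge has [r] vertices of distinct colours, so every colour occurs and [f] maps the edge onto a
   transversal of the box. *)
have full : c @: e = setT.
  apply/eqP; rewrite eqEcard subsetT card_in_imset; last exact: c_inj.
  by rewrite cardsT card_ord (eqP (forall_inP rF e eF)) /=.
have /fin_all_exists[g gP] : forall i, exists v, v \in e /\ c v = i.
  move=> i; have /imsetP[v ve ->] : i \in c @: e by rewrite full inE.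
  by exists v.
have /andP[_] := box (f \o g) (fun i => eq_ind _ (fun j => f (g i) \in T j) (fT _) _ (gP i).2).
congr (_ \in H); apply/setP => x; rewrite inE.
apply/codomP/imsetP => [[i ->]|[v ve ->]].
  by exists (g i); rewrite ?ffunE // (gP i).1.
exists (c v); rewrite ffunE /=; congr f.
by apply: (c_inj e) => //; rewrite (gP (c v)).1 || rewrite (gP (c v)).2.
Qed.

(** * Sublinearity and the limit *)

Lemma partite_coex_small (r : nat) (V : finType) (F : {set {set V}}) (c : nat) :
  is_rgraph r F -> partite r F ->
  exists N : nat, forall n, N <= n -> c * coex_pos r F n <= n.
Proof.
move=> rF pF; have [N hN] := dense_box r (c ^ r) #|V|.
exists N => n hn; rewrite /coex_pos.
elim/big_ind: _ => [|a b ha hb|H /andP[rH Ffree]]; first by rewrite muln0.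
  by rewrite maxnMr geq_max ha.
rewrite leqNgt; apply: contra Ffree => dense.
have d0 : 0 < min_pos_codegree r H by move: dense; case: min_pos_codegree; rewrite ?muln0.
have [|//|T cardT box] := hN 'I_n (ordered_edge H).
- by rewrite card_ord.
(* If [c * d > n] for the positive co-degree [d], the at least [d ^ r] ordered edges have density at
   least [1 / c ^ r]. *)
- rewrite card_ord; apply: leq_trans (_ : (c * min_pos_codegree r H) ^ r <= _).
    by case: (r) dense => // r' h; rewrite leq_exp2r // ltnW.
  by rewrite expnMn leq_mul2l ordered_edges_density ?orbT.
exact: box_contains rF pF cardT box.
Qed.

Local Open Scope ring_scope.
Import Order.TTheory GRing.Theory Num.Theory.

Theorem corollary26 (R : realType) (r : nat) (hr : (2 <= r)%N)
    (V : finType) (F : {set {set V}}) (hF : is_rgraph r F)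
    (hpart : partite r F) :
  cvgn (coex_pos_density R r F) /\ gamma_pos R r F = 0%R.
Proof.
suff cvg0 : (coex_pos_density R r F @ \oo --> (0 : R))%classic.
  split; first by apply/cvg_ex; exists 0.
  exact/cvg_lim.
apply/cvgr0Pnorm_le => e e0.
(* This integer exceeds [1 / e], so a ratio of at most [1 / c] is below [e]. *)
pose c := (Num.truncn e^-1).+1.
have [N hN] := partite_coex_small r V F c hF hpart.
near=> n.
have n0 : (0 < n)%N by near: n; exists 1%N.
rewrite ger0_norm ?divr_ge0 // ler_pdivrMr ?ltr0n //.
have ce : 1 <= c%:R * e.
  by rewrite -ler_pdivrMr // div1r ltW // truncnS_gt.
apply: le_trans (_ : c%:R * e * (coex_pos r F n)%:R <= _).
  by rewrite ler_peMl.
rewrite mulrC mulrA -natrM mulrC ler_pM2l // ler_nat mulnC.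
by apply: hN; near: n; exists N.
Unshelve. all: by end_near.
Qed.
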